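(* Let $\Gamma$ be a finitely generated sofic group with a sofic approximation $\mathcal X$, let $\mathcal G$ be the associated sofic coarse boundary groupoid and let $Z\subset\partial\beta X$ be the core of the sofic boundary. Then the reduction groupoid $\mathcal G|_Z$ and the transformation groupoid $Z\rtimes\Gamma$ are isomorphic as topological groupoids.
   Context: **Sofic approximations.** $\Gamma$ is a group with finite generating set $S$. For a finite $F\subset\Gamma$ and $\varepsilon\ge 0$, a map $\sigma:\Gamma\to \mathrm{Sym}(V)$, $V$ a nonempty finite set, is an $(F,\varepsilon)$-injective almost action if there is $Y\subset V$ with $|Y|\ge(1-\varepsilon)|V|$, $\sigma(g)\sigma(h)(y)=\sigma(gh)(y)$ for all $g,h\in F$, $y\in Y$, and $\sigma(g)(y)\ne y$ for all $g\in F\setminus\{e\}$, $y\in Y$. $\Gamma$ is sofic if such almost actions exist for every finite $F$ and every $\varepsilon>0$. A sofic approximation $\mathcal X=\{X_i,\sigma_i\}_{i\in\mathbb N}$ consists of finite sets $X_i$ with $(F_i,\varepsilon_i)$-injective almost actions $\sigma_i:\Gamma\to\mathrm{Sym}(X_i)$, where $(F_i)$ is a nested sequence of finite subsets with union $\Gamma$ and $\varepsilon_i\to0$. Each $X_i$ is made an $S$-labelled graph by joining $x$ to $\sigma_i(s)(x)$ by an edge labelled $s\in S$; these graphs are always assumed connected. The space of graphs is $X=\bigsqcup_i X_i$ with any metric $d$ restricting to the edge metric on each $X_i$ and with $d(X_i,X_j)\to\infty$ as $i+j\to\infty$, $i\neq j$. **Groupoids.** Let $E_R=\{(x,y)\in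 X\times X:d(x,y)\le R\}$. The coarse groupoid is $G(X)=\bigcup_{R>0}\overline{E_R}$, closures in $\beta X\times\beta X$, with pair groupoid operations and the weak topology (a set is open iff its intersection with each $\overline{E_R}$ is open in $\overline{E_R}$); its unit space is $\beta X$. The set $\partial\beta X=\beta X\setminus X$ is saturated, and the sofic coarse boundary groupoid is the reduction $\mathcal G=\partial G(X)=G(X)|_{\partial\beta X}$. For a saturated set $C$ of units, the reduction to $C$ consists of the elements with source and range in $C$. **Core.** Fix subsets $Y_i\subset X_i$, $|Y_i|\ge(1-\varepsilon_i)|X_i|$, witnessing the almost actions, and put $Y=\bigsqcup_iY_i$, $\partial Y=\overline Y\setminus X$ (closure in $\beta X$). For $g\in\Gamma$ let $\sigma(g):X\to X$ be the bijection equal to $\sigma_i(g)$ on $X_i$, extended to a homeomorphism of $\beta X$. The core is $Z=\bigcap_{g\in\Gamma}\sigma(g)(\partial Y)$, a closed saturated subset of $\partial\beta X$ on which the maps $\sigma(g)$ define an action of $\Gamma$. $Z\rtimes\Gamma$ is the transformation groupoid of this action ($s(z,g)=z$, $r(z,g)=\sigma(g)z$, product topology on $Z\times\Gamma$). *)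

(* Defs.v *)
From HB Require Import structures.
From mathcomp Require Import all_boot all_order all_algebra all_fingroup finmap.
From mathcomp Require Import boolp classical_sets functions reals.
From mathcomp Require Import topology normedtype sequences.

Set Implicit Arguments.
Unset Strict Implicit.
Unset Printing Implicit Defensive.

Import Order.TTheory GRing.Theory Num.Theory.
Import numFieldTopology.Exports numFieldNormedType.Exports.

Local Open Scope classical_set_scope.
Local Open Scope ring_scope.

(* [T] is regarded as a discrete space; its Stone-Cech compactification is the
   space of ultrafilters on [T], the sets of ultrafilters containing a given
   subset of [T] forming a base of the topology. *)

Record stone_cech (T : Type) := StoneCech {
  ultra : set_system T;
  ultraP : UltraFilter ultra
}.
#[global] Existing Instance ultraP.

HB.instance Definition _ (T : Type) := gen_eqMixin (stone_cech T).
HB.instance Definition _ (T : Type) := gen_choiceMixin (stone_cech T).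

Section StoneCech.
Context {T : Type}.

Definition sc_open (U : set (stone_cech T)) : Prop :=
  forall p, U p -> exists2 A, ultra p A & [set q | ultra q A] `<=` U.

Lemma sc_openT : sc_open setT.
Proof. by move=> p _; exists setT => //; exact: filterT. Qed.

Lemma sc_openI : setI_closed sc_open.
Proof.
move=> U V oU oV p [/oU[A pA AU] /oV[B pB BV]]; exists (A `&` B).
  exact: filterI.
by move=> q qAB; split; [apply: AU|apply: BV]; apply: filterS qAB => x [].
Qed.

Lemma sc_open_bigU (I : Type) (f : I -> set (stone_cech T)) :
  (forall i, sc_open (f i)) -> sc_open (\bigcup_i f i).
Proof.
move=> of_ p [i _ /of_[A pA AU]]; exists A => // q /AU fq.
by exists i.
Qed.

End StoneCech.

HB.instance Definition _ (T : Type) :=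
  isOpenTopological.Build (stone_cech T) sc_openT sc_openI sc_open_bigU.

Section StoneCechTheory.
Context {T : Type}.
Implicit Types p q : stone_cech T.

Lemma stone_cechP p q : ultra p `<=` ultra q -> p = q.
Proof.
case: p q => [F UF] [G UG] /= FG.
have E : G = F by exact: max_filter.
by rewrite E in UG *; congr StoneCech; exact: Prop_irrelevance.
Qed.

Definition sc_point (x : T) : stone_cech T :=
  StoneCech (principal_filter_ultra x).

Lemma ultra_setC p (A : set T) : ultra p (~` A) <-> ~ ultra p A.
Proof.
split; last by case: (in_ultra_setVsetC A (ultraP p)).
by move=> pC pA; apply: (@filter_not_empty _ (ultra p)); rewrite -(setICr A); exact: filterI.
Qed.

Lemma ultra_ex p (A : set T) : ultra p A -> exists x, A x.
Proof. by move=> /filter_ex[x Ax]; exists x. Qed.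

Lemma sc_nbhsP p (U : set (stone_cech T)) :
  nbhs p U <-> exists2 A, ultra p A & [set q | ultra q A] `<=` U.
Proof.
split.
  rewrite nbhsE => -[V [oV Vp] VU].
  by have [A pA AV] := oV p Vp; exists A => //; exact: subset_trans VU.
move=> [A pA AU]; rewrite nbhsE; exists [set q | ultra q A] => //.
by split => //; rewrite /open /= => q qA; exists A.
Qed.

Lemma sc_point_eq p (x : T) : ultra p [set x] -> p = sc_point x.
Proof.
move=> px; symmetry; apply: stone_cechP => A /= /principal_filterP Ax.
by apply: filterS px => y ->.
Qed.

Definition sc_closure2 (E : set (T * T)) : set (stone_cech T * stone_cech T) :=
  closure [set (sc_point e.1, sc_point e.2) | e in E].

Lemma sc_closure2P (E : set (T * T)) (a : stone_cech T * stone_cech T) :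
  sc_closure2 E a <->
  forall A B, ultra a.1 A -> ultra a.2 B ->
    exists x y, [/\ A x, B y & E (x, y)].
Proof.
case: a => p q; split => /= [cE A B pA qB|H N].
  have [_ [[[x y] Exy <-] /= [/principal_filterP Ax /principal_filterP By]]] :
      [set (sc_point e.1, sc_point e.2) | e in E] `&`
      ([set u | ultra u A] `*` [set u | ultra u B]) !=set0.
    apply: cE; exists ([set u | ultra u A], [set u | ultra u B]) => //=.
    by split; apply/sc_nbhsP; [exists A|exists B].
  by exists x, y.
move=> [[N1 N2]] /= [/sc_nbhsP[A pA AN] /sc_nbhsP[B qB BN]] NN.
have [x [y [Ax By Exy]]] := H _ _ pA qB.
exists (sc_point x, sc_point y); split; first by exists (x, y).
by apply: NN; split => /=; [apply: AN|apply: BN]; exact/principal_filterP.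
Qed.

End StoneCechTheory.

Lemma sc_map_ultra (T U : Type) (f : T -> U) (p : stone_cech T) :
  UltraFilter [set A | ultra p (f @^-1` A)].
Proof.
split.
  split=> [|]; first by rewrite /= preimage_set0; exact: filter_not_empty.
  split=> [|A B|A B AB] /=; first by rewrite preimage_setT; exact: filterT.
    by rewrite preimage_setI; exact: filterI.
  by apply: filterS => x; exact: AB.
move=> G GP FG; apply/seteqP; split => // A GA /=.
apply: contrapT => /ultra_setC pC.
have GC : G (~` A) by exact: FG.
apply: (@filter_not_empty _ G); rewrite -(setICr A).
exact: filterI.
Qed.

(* The continuous extension of [f] to the Stone-Cech compactifications. *)
Definition sc_map (T U : Type) (f : T -> U) (p : stone_cech T) : stone_cech U :=
  StoneCech (sc_map_ultra f p).

(* [gmul a b] is the product [ab], defined when the source of [a] is the range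
   of [b]. Continuity of the operations is not part of the structure; it plays
   no role in the notion of isomorphism. *)

Record top_groupoid := TopGroupoid {
  arrow : topologicalType;
  gunit : topologicalType;
  gsrc : arrow -> gunit;
  grng : arrow -> gunit;
  gone : gunit -> arrow;
  ginv : arrow -> arrow;
  gmul : forall a b : arrow, gsrc a = grng b -> arrow;
  gsrc_one : forall u, gsrc (gone u) = u;
  grng_one : forall u, grng (gone u) = u;
  gsrc_inv : forall a, gsrc (ginv a) = grng a;
  grng_inv : forall a, grng (ginv a) = gsrc a;
  gsrc_mul : forall a b (h : gsrc a = grng b), gsrc (gmul h) = gsrc b;
  grng_mul : forall a b (h : gsrc a = grng b), grng (gmul h) = grng a;
  gmulA : forall a b c (hab : gsrc a = grng b) (hbc : gsrc b = grng c)
    (h1 : gsrc a = grng (gmul hbc)) (h2 : gsrc (gmul hab) = grng c),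
    gmul h1 = gmul h2;
  gmul1a : forall a (h : gsrc (gone (grng a)) = grng a), gmul h = a;
  gmula1 : forall a (h : gsrc a = grng (gone (gsrc a))), gmul h = a;
  gmulVa : forall a (h : gsrc (ginv a) = grng a), gmul h = gone (gsrc a);
  gmulaV : forall a (h : gsrc a = grng (ginv a)), gmul h = gone (grng a)
}.

Definition homeomorphism (T U : topologicalType) (f : T -> U) : Prop :=
  exists g : U -> T,
    [/\ cancel f g, cancel g f, continuous f & continuous g].

Record groupoid_isomorphism (G H : top_groupoid)
    (f : arrow G -> arrow H) (f0 : gunit G -> gunit H) : Prop := {
  giso_arrow : homeomorphism f;
  giso_unit : homeomorphism f0;
  giso_src : forall a, gsrc (f a) = f0 (gsrc a);
  giso_rng : forall a, grng (f a) = f0 (grng a);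
  giso_one : forall u, f (gone u) = gone (f0 u);
  giso_inv : forall a, f (ginv a) = ginv (f a);
  giso_mul : forall a b (h : gsrc a = grng b) (h' : gsrc (f a) = grng (f b)),
    f (gmul h) = gmul h'
}.

Definition isomorphic_top_groupoids (G H : top_groupoid) : Prop :=
  exists (f : arrow G -> arrow H) (f0 : gunit G -> gunit H),
    groupoid_isomorphism f f0.

Section Reduction.
Variables (G : top_groupoid) (C : set (gunit G)).

Definition red_arrows : set (arrow G) := [set a | C (gsrc a) /\ C (grng a)].

Lemma red_srcP (a : red_arrows) : gsrc (val a) \in C.
Proof. by apply/mem_set; have /set_mem[] := valP a. Qed.

Lemma red_rngP (a : red_arrows) : grng (val a) \in C.
Proof. by apply/mem_set; have /set_mem[] := valP a. Qed.

Definition red_src (a : red_arrows) : C := exist _ (gsrc (val a)) (red_srcP a).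
Definition red_rng (a : red_arrows) : C := exist _ (grng (val a)) (red_rngP a).

Lemma red_oneP (u : C) : gone (val u) \in red_arrows.
Proof.
apply/mem_set; rewrite /red_arrows /= gsrc_one grng_one.
by have /set_mem := valP u.
Qed.

Definition red_one (u : C) : red_arrows := exist _ (gone (val u)) (red_oneP u).

Lemma red_invP (a : red_arrows) : ginv (val a) \in red_arrows.
Proof.
apply/mem_set; rewrite /red_arrows /= gsrc_inv grng_inv.
by have /set_mem[] := valP a.
Qed.

Definition red_inv (a : red_arrows) : red_arrows :=
  exist _ (ginv (val a)) (red_invP a).

Definition red_comp (a b : red_arrows) (h : red_src a = red_rng b) :
  gsrc (val a) = grng (val b) := congr1 val h.

Lemma red_mulP (a b : red_arrows) (h : red_src a = red_rng b) :
  gmul (red_comp h) \in red_arrows.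
Proof.
apply/mem_set; rewrite /red_arrows /= gsrc_mul grng_mul.
by have /set_mem[_ ?] := valP a; have /set_mem[? _] := valP b.
Qed.

Definition red_mul (a b : red_arrows) (h : red_src a = red_rng b) :
  red_arrows := exist _ (gmul (red_comp h)) (red_mulP h).

Program Definition reduction : top_groupoid := {|
  arrow := red_arrows; gunit := C;
  gsrc := red_src; grng := red_rng; gone := red_one; ginv := red_inv;
  gmul := red_mul |}.
Next Obligation. by move=> u; apply/val_inj; exact: gsrc_one. Qed.
Next Obligation. by move=> u; apply/val_inj; exact: grng_one. Qed.
Next Obligation. by move=> a; apply/val_inj; exact: gsrc_inv. Qed.
Next Obligation. by move=> a; apply/val_inj; exact: grng_inv. Qed.
Next Obligation. by move=> a b h; apply/val_inj; exact: gsrc_mul. Qed.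
Next Obligation. by move=> a b h; apply/val_inj; exact: grng_mul. Qed.
Next Obligation. by move=> a b c hab hbc h1 h2; apply/val_inj; exact: gmulA. Qed.
Next Obligation. by move=> a h; apply/val_inj; exact: gmul1a. Qed.
Next Obligation. by move=> a h; apply/val_inj; exact: gmula1. Qed.
Next Obligation. by move=> a h; apply/val_inj; exact: gmulVa. Qed.
Next Obligation. by move=> a h; apply/val_inj; exact: gmulaV. Qed.

End Reduction.

Section TransformationGroupoid.
Variables (Gamma : groupType) (T : topologicalType) (act : Gamma -> T -> T).
Hypothesis act1 : forall z, act 1%g z = z.
Hypothesis actM : forall g h z, act (g * h)%g z = act g (act h z).

Let arr : topologicalType := (T * discrete_topology Gamma)%type.
Let tsrc (a : arr) : T := a.1.
Let trng (a : arr) : T := act a.2 a.1.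
Let tone (z : T) : arr := (z, 1%g : Gamma).
Let tinv (a : arr) : arr := (act a.2 a.1, (a.2 : Gamma)^-1%g).
Let tmul (a b : arr) (_ : tsrc a = trng b) : arr :=
  (b.1, ((a.2 : Gamma) * (b.2 : Gamma))%g).

Program Definition transformation_groupoid : top_groupoid := {|
  arrow := arr; gunit := T;
  gsrc := tsrc; grng := trng; gone := tone; ginv := tinv; gmul := tmul |}.
Next Obligation. by []. Qed.
Next Obligation. by move=> u; exact: act1. Qed.
Next Obligation. by []. Qed.
Next Obligation. by move=> [z g]; rewrite /trng /tinv /= -actM mulVg act1. Qed.
Next Obligation. by []. Qed.
Next Obligation.
by move=> [z g] [w h]; rewrite /tsrc /trng /= => ->; rewrite actM.
Qed.
Next Obligation.
by move=> [z g] [w h] [v k] *; rewrite /tmul /= mulgA.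
Qed.
Next Obligation. by move=> [z g] h; rewrite /tmul /= mul1g. Qed.
Next Obligation. by move=> [z g] h; rewrite /tmul /tsrc /= mulg1. Qed.
Next Obligation. by move=> [z g] h; rewrite /tmul /tone /tsrc /= mulVg. Qed.
Next Obligation. by move=> [z g] h; rewrite /tmul /tone /trng /= mulgV. Qed.

End TransformationGroupoid.

Record is_metric (R : realType) (X : Type) (d : X -> X -> R) : Prop := {
  metric_ge0 : forall x y, 0 <= d x y;
  metric_eq0 : forall x y, d x y = 0 <-> x = y;
  metric_symm : forall x y, d x y = d y x;
  metric_tri : forall y x z, d x z <= d x y + d y z
}.

Section CoarseGroupoid.
Variables (R : realType) (X : Type) (d : X -> X -> R).

Definition entourage_le (r : R) : set (X * X) := [set e | d e.1 e.2 <= r].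

Definition coarse_arrows : set (stone_cech X * stone_cech X) :=
  \bigcup_(r in [set r | 0 < r]) sc_closure2 (entourage_le r).

(* A separate constant, as the weak topology given to it below is not the
   subspace topology carried by [set_type coarse_arrows]. *)
Definition coarse_arrow : Type := {a | a \in coarse_arrows}.

HB.instance Definition _ := Choice.on coarse_arrow.

Definition coarse_pair (a : coarse_arrow) : stone_cech X * stone_cech X :=
  sval a.

(* Weak topology: [U] is relatively open in the closure of each entourage. *)
Definition coarse_open (U : set coarse_arrow) : Prop :=
  forall r : R, 0 < r -> exists2 O : set (stone_cech X * stone_cech X),
    open O & forall a, sc_closure2 (entourage_le r) (coarse_pair a) ->
                       (U a <-> O (coarse_pair a)).

Lemma coarse_openT : coarse_open setT.
Proof. by move=> r _; exists setT; [exact: openT|]. Qed.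

Lemma coarse_openI : setI_closed coarse_open.
Proof.
move=> U V oU oV r r0; have [A oA UA] := oU r r0; have [B oB VB] := oV r r0.
exists (A `&` B); first exact: openI.
by move=> a ha; rewrite /setI /=; split=> -[/(UA a ha) ? /(VB a ha) ?].
Qed.

Lemma coarse_open_bigU (I : Type) (f : I -> set coarse_arrow) :
  (forall i, coarse_open (f i)) -> coarse_open (\bigcup_i f i).
Proof.
move=> fo r r0; pose P i O := open O /\ forall a,
  sc_closure2 (entourage_le r) (coarse_pair a) -> (f i a <-> O (coarse_pair a)).
exists (\bigcup_(O in [set O | exists i, P i O]) O).
  by apply: bigcup_open => O [i []].
move=> a ha; split=> [[i _ fia]|[O [i [_ /(_ a ha) fO]] Oa]].
  have [O oO fO] := fo i r r0; exists O; first by exists i.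
  exact/(fO a ha).
by exists i => //; exact/fO.
Qed.

HB.instance Definition _ := isOpenTopological.Build coarse_arrow
  coarse_openT coarse_openI coarse_open_bigU.

Hypothesis dM : is_metric d.

Definition coarse_src (a : coarse_arrow) : stone_cech X := (coarse_pair a).2.
Definition coarse_rng (a : coarse_arrow) : stone_cech X := (coarse_pair a).1.

Lemma coarse_oneP (p : stone_cech X) : (p, p) \in coarse_arrows.
Proof.
apply/mem_set; exists 1 => //=; apply/sc_closure2P => A B pA pB.
have [x [Ax Bx]] : exists x, (A `&` B) x by apply: ultra_ex; exact: filterI pA pB.
by exists x, x; split => //; rewrite /entourage_le /= (metric_eq0 dM x x).2.
Qed.

Definition coarse_one (p : stone_cech X) : coarse_arrow :=
  exist _ (p, p) (coarse_oneP p).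

Lemma coarse_invP (a : coarse_arrow) :
  (coarse_src a, coarse_rng a) \in coarse_arrows.
Proof.
case: a => [[p q] hpq]; have /set_mem[r r0 /sc_closure2P H] := hpq.
apply/mem_set; exists r => //; apply/sc_closure2P => A B /= qA pB.
have [x [y [Bx Ay xy]]] := H _ _ pB qA; exists y, x; split => //.
by rewrite /entourage_le /= (metric_symm dM).
Qed.

Definition coarse_inv (a : coarse_arrow) : coarse_arrow :=
  exist _ (coarse_src a, coarse_rng a) (coarse_invP a).

Lemma coarse_mulP (a b : coarse_arrow) : coarse_src a = coarse_rng b ->
  (coarse_rng a, coarse_src b) \in coarse_arrows.
Proof.
case: a b => [[p q] hpq] [[q' u] hqu].
have /set_mem[r r0 /sc_closure2P H] := hpq.
have /set_mem[s s0 /sc_closure2P K] := hqu.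
rewrite /coarse_src /coarse_rng /= => qq'; subst q'; apply/mem_set.
exists (r + s); first exact: addr_gt0.
apply/sc_closure2P => A B /= pA uB.
pose A' := [set y | exists2 x, A x & d x y <= r].
pose B' := [set y | exists2 z, B z & d y z <= s].
have qA' : ultra q A'.
  apply: contrapT => /ultra_setC qC; have [x [y [Ax nA xy]]] := H _ _ pA qC.
  by apply: nA; exists x.
have qB' : ultra q B'.
  apply: contrapT => /ultra_setC qC; have [y [z [nB Bz yz]]] := K _ _ qC uB.
  by apply: nB; exists z.
have [y [[x Ax xy] [z Bz yz]]] : exists y, (A' `&` B') y.
  by apply: ultra_ex; exact: filterI qA' qB'.
exists x, z; split => //; rewrite /entourage_le /=.
exact: le_trans (metric_tri dM y x z) (lerD xy yz).
Qed.

Definition coarse_mul (a b : coarse_arrow)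
    (h : coarse_src a = coarse_rng b) : coarse_arrow :=
  exist _ (coarse_rng a, coarse_src b) (coarse_mulP h).

Lemma coarse_eq (a b : coarse_arrow) :
  coarse_rng a = coarse_rng b -> coarse_src a = coarse_src b -> a = b.
Proof.
case: a b => [[p q] hp] [[p' q'] hp'] /= pp' qq'; apply: val_inj => /=.
by congr (_, _).
Qed.

Program Definition coarse_groupoid : top_groupoid := {|
  arrow := coarse_arrow; gunit := stone_cech X;
  gsrc := coarse_src; grng := coarse_rng; gone := coarse_one;
  ginv := coarse_inv; gmul := coarse_mul |}.
Next Obligation. by []. Qed.
Next Obligation. by []. Qed.
Next Obligation. by []. Qed.
Next Obligation. by []. Qed.
Next Obligation. by []. Qed.
Next Obligation. by []. Qed.
Next Obligation. by move=> a b c hab hbc h1 h2; exact: coarse_eq. Qed.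
Next Obligation. by move=> a h; exact: coarse_eq. Qed.
Next Obligation. by move=> a h; exact: coarse_eq. Qed.
Next Obligation. by move=> a h; exact: coarse_eq. Qed.
Next Obligation. by move=> a h; exact: coarse_eq. Qed.

Definition sc_boundary : set (stone_cech X) := ~` range (@sc_point X).

Definition boundary_groupoid : top_groupoid :=
  @reduction coarse_groupoid sc_boundary.

End CoarseGroupoid.

Definition generates (Gamma : groupType) (S : {fset Gamma}) : Prop :=
  forall H : {pred Gamma},
    group_closed H -> {subset S <= H} -> forall g, g \in H.

Record almost_action_witness (R : realType) (Gamma : groupType) (V : finType)
    (F : {fset Gamma}) (eps : R) (sigma : Gamma -> {perm V}) (Y : {set V}) :
    Prop := {
  witness_card : (1 - eps) * #|V|%:R <= #|Y|%:R;
  witness_mul : forall g h y, g \in F -> h \in F -> y \in Y ->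
    sigma g (sigma h y) = sigma (g * h)%g y;
  witness_free : forall g y, g \in F -> g != 1%g -> y \in Y -> sigma g y != y
}.

Definition almost_action (R : realType) (Gamma : groupType) (V : finType)
    (F : {fset Gamma}) (eps : R) (sigma : Gamma -> {perm V}) : Prop :=
  (0 < #|V|)%N /\ exists Y : {set V}, almost_action_witness F eps sigma Y.

Definition sofic (R : realType) (Gamma : groupType) : Prop :=
  forall (F : {fset Gamma}) (eps : R), 0 < eps ->
    exists (V : finType) (sigma : Gamma -> {perm V}), almost_action F eps sigma.

Definition label_adj (Gamma : groupType) (S : {fset Gamma}) (V : finType)
    (sigma : Gamma -> {perm V}) : rel V :=
  fun x y => [exists s : S, (sigma (val s) x == y) || (sigma (val s) y == x)].

Record sofic_approximation (R : realType) (Gamma : groupType)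
    (S : {fset Gamma}) := SoficApproximation {
  sa_space : nat -> finType;
  sa_map : forall i, Gamma -> {perm sa_space i};
  sa_fin : nat -> {fset Gamma};
  sa_eps : nat -> R;
  sa_fin_nested : forall i, {subset sa_fin i <= sa_fin i.+1};
  sa_fin_cover : forall g, exists i, g \in sa_fin i;
  sa_eps_ge0 : forall i, 0 <= sa_eps i;
  sa_eps_cvg0 : sa_eps @ \oo --> 0;
  sa_almost : forall i, almost_action (sa_fin i) (sa_eps i) (sa_map i);
  sa_connected : forall i x y, connect (label_adj S (sa_map i)) x y
}.

(* Smallest length of a path from [x] to [y] in the graph [e]; the junk value
   is [0] if there is none. *)
Definition edge_dist (R : realType) (V : finType) (e : rel V) (x y : V) : R :=
  inf [set (size p)%:R | p in [set p | path e x p /\ last x p = y]].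

Section SoficBoundary.
Variables (R : realType) (Gamma : groupType) (S : {fset Gamma}).
Variable A : sofic_approximation R S.

Definition graph_space : Type := {i : nat & sa_space A i}.

Definition in_graph (i : nat) (x : sa_space A i) : graph_space :=
  existT (fun i => sa_space A i) i x.

Definition component_dist (d : graph_space -> graph_space -> R) (i j : nat) : R :=
  inf [set d (in_graph x) (in_graph y) | x in [set: sa_space A i]
                                       & y in [set: sa_space A j]].

Record graph_space_metric (d : graph_space -> graph_space -> R) : Prop := {
  gsm_metric : is_metric d;
  gsm_edge : forall i (x y : sa_space A i),
    d (in_graph x) (in_graph y) = edge_dist R (label_adj S (sa_map A i)) x y;
  gsm_far : forall M : R, exists N : nat, forall i j : nat,
    i != j -> (N <= i + j)%N -> M <= component_dist d i j
}.

Definition total_map (g : Gamma) (x : graph_space) : graph_space :=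
  in_graph (sa_map A (projT1 x) g (projT2 x)).

Definition beta_map (g : Gamma) : stone_cech graph_space -> stone_cech graph_space :=
  sc_map (total_map g).

Variable Y : forall i, {set sa_space A i}.

Definition total_set : set graph_space := [set x | projT2 x \in Y (projT1 x)].

Definition boundary_of_total_set : set (stone_cech graph_space) :=
  closure [set sc_point x | x in total_set] `\` range (@sc_point graph_space).

Definition core : set (stone_cech graph_space) :=
  \bigcap_(g in [set: Gamma]) [set beta_map g p | p in boundary_of_total_set].

Hypothesis Yw : forall i,
  almost_action_witness (sa_fin A i) (sa_eps A i) (sa_map A i) (Y i).

Lemma boundary_total_setP p : boundary_of_total_set p -> ultra p total_set.
Proof.
move=> [cY _]; apply: contrapT => /ultra_setC pC.
have [_ [[x Yx <-] /principal_filterP]] : [set sc_point x | x in total_set] `&`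
    [set q | ultra q (~` total_set)] !=set0.
  by apply: cY; apply/sc_nbhsP; exists (~` total_set).
by [].
Qed.

Lemma boundary_tail p n : ~ range (@sc_point graph_space) p ->
  ultra p [set x | (n <= projT1 x)%N].
Proof.
move=> np; elim: n => [|n IHn]; first by apply: filterS filterT.
suff pn : ultra p (~` [set x | projT1 x = n]).
  by apply: filterS (filterI IHn pn) => x [/= nx /eqP xn]; rewrite ltn_neqAle eq_sym xn.
have sub (s : seq (sa_space A n)) :
    ultra p (~` [set x | exists2 v, v \in s & x = in_graph v]).
  elim: s => [|v s IHs]; first by apply: filterS filterT => x _ [].
  have pv : ultra p (~` [set in_graph v]).
    apply/ultra_setC => pv; apply: np; exists (in_graph v) => //.
    by rewrite (sc_point_eq pv).
  apply: filterS (filterI IHs pv) => x [xs xv] [w]; rewrite inE.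
  by move=> /orP[/eqP -> /xv//|ws xw]; apply: xs; exists w.
apply: filterS (sub (enum (sa_space A n))) => -[m v] /= nx mn; apply: nx.
by subst m; exists v => //; rewrite mem_enum.
Qed.

Lemma sa_finS i j g : (i <= j)%N -> g \in sa_fin A i -> g \in sa_fin A j.
Proof.
move=> ij gi; rewrite -(subnK ij); elim: (j - i)%N => // k IHk.
by rewrite addSn; exact: sa_fin_nested.
Qed.

Lemma beta_map_ext (f f' : graph_space -> graph_space) p (B : set graph_space) :
  ultra p B -> (forall x, B x -> f x = f' x) -> sc_map f p = sc_map f' p.
Proof.
move=> pB ff'; apply: stone_cechP => C /= pC.
by apply: filterS (filterI pB pC) => x [Bx]; rewrite /= ff'.
Qed.

Lemma total_mapM_near p g h : boundary_of_total_set p ->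
  exists2 B, ultra p B & forall x, B x ->
    total_map g (total_map h x) = total_map (g * h)%g x.
Proof.
move=> /[dup] /boundary_total_setP pY [_ np].
have [i gi] := sa_fin_cover A g; have [j hj] := sa_fin_cover A h.
exists (total_set `&` [set x | (maxn i j <= projT1 x)%N]).
  exact: filterI pY (boundary_tail _ np).
move=> [k v] [/= Yv]; rewrite geq_max => /andP[ik jk].
rewrite /total_map /=; congr in_graph; apply: (witness_mul (Yw k)) => //.
  exact: sa_finS gi.
exact: sa_finS hj.
Qed.

Lemma beta_mapM p g h : boundary_of_total_set p ->
  beta_map g (beta_map h p) = beta_map (g * h)%g p.
Proof.
move=> /(total_mapM_near g h)[B pB gh].
have -> : beta_map (g * h)%g p = sc_map (total_map g \o total_map h) p.
  by symmetry; exact: beta_map_ext pB gh.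
exact: stone_cechP.
Qed.

Lemma total_map_inj g : injective (total_map g).
Proof.
pose f (x : graph_space) := in_graph ((sa_map A (projT1 x) g)^-1%g (projT2 x)).
by apply: (can_inj (g := f)) => -[i v]; rewrite /f /total_map /= permK.
Qed.

Lemma beta_map1 p : boundary_of_total_set p -> beta_map 1%g p = p.
Proof.
move=> /(total_mapM_near 1%g 1%g)[B pB gh].
have H x : B x -> total_map 1%g x = id x.
  by move=> /gh; rewrite mulg1 => /total_map_inj.
by rewrite /beta_map (beta_map_ext pB H); exact: stone_cechP.
Qed.

Lemma core_boundary_total_set : core `<=` boundary_of_total_set.
Proof.
by move=> z /(_ 1%g I)[p pY <-]; rewrite beta_map1.
Qed.

Lemma beta_map_core g (z : core) : beta_map g (val z) \in core.
Proof.
apply/mem_set => h _; have /set_mem/(_ (g^-1 * h)%g I)[p pY <-] := valP z.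
by exists p => //; rewrite beta_mapM // mulKVg.
Qed.

Definition core_act (g : Gamma) (z : core) : core :=
  exist _ (beta_map g (val z)) (beta_map_core g z).

Lemma core_act1 z : core_act 1%g z = z.
Proof.
apply: val_inj; apply: beta_map1; apply: core_boundary_total_set.
by have /set_mem := valP z.
Qed.

Lemma core_actM g h z : core_act (g * h)%g z = core_act g (core_act h z).
Proof.
apply: val_inj; symmetry; apply: beta_mapM; apply: core_boundary_total_set.
by have /set_mem := valP z.
Qed.

Definition core_transformation_groupoid : top_groupoid :=
  transformation_groupoid core_act1 core_actM.

Definition core_units : set (set_type (@sc_boundary graph_space)) :=
  [set u | core (val u)].

End SoficBoundary.

(* Main.v *)
Require Import Defs.
From mathcomp Require Import all_boot all_algebra finmap classical_sets reals.
From mathcomp Require Import all_fingroup order boolp topology.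

Set Implicit Arguments.
Unset Strict Implicit.
Unset Printing Implicit Defensive.

Import Order.TTheory GRing.Theory Num.Theory.

Local Open Scope classical_set_scope.
Local Open Scope ring_scope.

(** The isomorphism sends an arrow [a] of the reduction to [(source of a, g)],
   where [g] is the unique group element with
   [range of a = beta_map g (source of a)]; its inverse sends [(z, g)] to the
   pair [(beta_map g z, z)]. Arrows of the coarse groupoid are pairs of
   ultrafilters, and arrows of the transformation groupoid of a free action are
   also determined by source and range. So once the two maps respect sources
   and ranges, the algebraic identities are automatic
   ([principal_groupoid_isomorphism]). What has to be shown is the existence
   and uniqueness of [g], that the pairs [(beta_map g z, z)] are arrows, and
   continuity in both directions.

   Existence. An arrow lies in the closure of an entourage of some radius [r].
   Far out, points at distance at most [r] lie in one component and are joined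
   by an edge path of bounded length, so one is the image of the other under
   one of finitely many words in the generators and their inverses
   ([entourage_words]). An ultrafilter chooses one of these words, which near
   the core acts as a group element ([sc_map_word_core]).

   Uniqueness. If the extensions of two injections agree at an ultrafilter,
   then the injections agree on a set of this ultrafilter ([agreement_ultra]);
   two different group elements never agree near the core, by freeness of the
   almost actions ([beta_map_free]).

   Continuity. Inside the closure of one entourage, [agreement_ultra] separates
   a translation from each of the finitely many competing words, except at
   those that already agree with it. Hence the graph of the translation is open
   in the weak topology ([translation_graph_open]), and the group element of an
   arrow is locally constant. Conversely, since the generators move points by
   at most one and the core is invariant, each group element has bounded
   displacement, uniformly over the core ([core_displacement]). So
   [(z, g) |-> (beta_map g z, z)] locally stays in the closure of a single
   entourage, where the weak topology is the product topology. *)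

(** * Ultrafilters and extensions of injections *)

Section Ultrafilters.
Context {T : Type}.
Implicit Types (p q : stone_cech T) (f h : T -> T).

Lemma stone_cech_separate p q : p <> q -> exists2 A, ultra p A & ultra q (~` A).
Proof.
move=> pq; apply: contrapT => npq; apply: pq; apply: stone_cechP => A pA.
by apply: contrapT => /ultra_setC qA; apply: npq; exists A.
Qed.

Lemma sc_map_comp (U V : Type) (f : U -> V) (g : T -> U) p :
  sc_map f (sc_map g p) = sc_map (f \o g) p.
Proof. exact: stone_cechP. Qed.

Lemma sc_map_continuous (U : Type) (f : T -> U) : continuous (sc_map f).
Proof.
move=> p W /sc_nbhsP[A pA AW]; apply/sc_nbhsP; exists (f @^-1` A) => // q qA.
exact: AW.
Qed.

(** This is the usual coloring argument, in a form that needs a single maximal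
   set. Among the sets [A] whose images under [f] and [h] are disjoint, take a
   maximal one: then every point where [f] and [h] differ belongs to [A] or is
   sent by one of the maps into the image of [A] under the other one. If the
   ultrafilter contained one of these three sets then, as both maps are
   injective and have the same image filter, it would contain [A], and the
   image filter would contain two disjoint sets. *)
Lemma agreement_ultra (U : Type) (f h : T -> U) p : injective f -> injective h ->
  sc_map f p = sc_map h p -> ultra p [set x | f x = h x].
Proof.
move=> f_inj h_inj fh; apply: contrapT => /ultra_setC pB.
pose P (A : set T) := forall a b, A a -> A b -> f a <> h b.
have [|A [PA Amax]] := @Zorn_bigcup T P.
  move=> F FP Ftot a b [X FX Xa] [Z FZ Zb].
  by case: (Ftot X Z FX FZ) => XZ; [apply: (FP Z)|apply: (FP X)] => //;
    apply: XZ.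
have memE (g : T -> U) (C : set U) : ultra (sc_map g p) C = ultra p (g @^-1` C) by [].
have notA : ~ ultra p A.
  move=> pA; have : ultra (sc_map f p) (f @` A).
    by rewrite memE; apply: filterS pA => a Aa; exists a.
  rewrite fh memE => pAA.
  have [b [Ab [a Aa /PA]]] := ultra_ex (filterI pA pAA).
  exact.
have cover : ~` [set x | f x = h x] `<=`
    A `|` (f @^-1` (h @` A) `|` h @^-1` (f @` A)).
  move=> x fx_hx; apply: contrapT => /not_orP[nAx /not_orP[nfx nhx]].
  apply: (Amax (A `|` [set x])).
    by split=> [a Aa|/(_ x) sub]; [left|apply/nAx/sub; right].
  (* An equality [f a = h b] involving [x] contradicts one of the three
     exclusions just made. *)
  move=> a b [Aa|->] [Ab|->] // e; first exact: PA e.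
    by apply: nhx; exists a.
  by apply: nfx; exists b.
have [//|pC] := in_ultra_setVsetC A (ultraP p).
have pA2 : ultra p (f @^-1` (h @` A) `|` h @^-1` (f @` A)).
  by apply: filterS (filterI pB pC) => x [/cover[]].
have [pf|/(filterI pA2) ph] := in_ultra_setVsetC (f @^-1` (h @` A)) (ultraP p).
  apply: notA; have : ultra (sc_map h p) (h @` A) by rewrite -fh.
  by rewrite memE; apply: filterS => x [a Aa /h_inj <-].
apply: notA; have : ultra (sc_map f p) (f @` A).
  by rewrite fh memE; apply: filterS ph => x [[]].
by rewrite memE; apply: filterS => x [a Aa /f_inj <-].
Qed.

Lemma closure2_sub_graph (E : set (T * T)) h A B p q :
  ultra p A -> ultra q B ->
  (forall y x, A y -> B x -> E (y, x) -> y = h x) ->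
  sc_closure2 E (p, q) -> p = sc_map h q.
Proof.
move=> pA qB EAB /sc_closure2P cE; apply: stone_cechP => C pC /=.
apply: contrapT => /ultra_setC qC.
have [y [x [[Ay Cy] [Bx nCx] Eyx]]] := cE _ _ (filterI pA pC) (filterI qB qC).
by apply: nCx; rewrite /= -(EAB y x).
Qed.

(** The covering hypothesis is the form in which the bounded geometry of the
   space of graphs enters. *)
Section FiniteCover.
Context {I : finType} (f : I -> T -> T) (E : set (T * T)) (D : set T).
Hypothesis E_cover : forall y x, D x -> E (y, x) -> exists i, y = f i x.

(** Pigeonhole principle for ultrafilters: were [p] separated from all the
   images of [q], intersecting the finitely many separating sets would leave a
   pair of [E] on none of the graphs. *)
Lemma closure2_finite_cover p q :
  ultra q D -> sc_closure2 E (p, q) -> exists i, p = sc_map (f i) q.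
Proof.
move=> qD /sc_closure2P cE; apply: contrapT => /forallNP pf.
have /choice[A AP] i : exists A, ultra p A /\ ultra (sc_map (f i) q) (~` A).
  by have [A] := stone_cech_separate (pf i); exists A.
have pA : ultra p [set y | forall i, A i y].
  by apply: filter_forall => i; have [] := AP i.
have qA : ultra q [set x | forall i, ~ A i (f i x)].
  by apply: filter_forall => i; have [_] := AP i.
have [y [x [/= Ay [Dx nAx] Eyx]]] := cE _ _ pA (filterI qD qA).
by have [i yE] := E_cover Dx Eyx; apply: (nAx i); rewrite -yE.
Qed.

(** Those [f i] whose extension at [q] differs from that of [h] are excluded by
   separating the two image ultrafilters; the other ones already agree with [h]
   on a set of [q], by [agreement_ultra]. *)
Lemma finite_cover_isolates_graph h q :
  (forall i, injective (f i)) -> injective h -> ultra q D ->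
  exists A B, [/\ ultra (sc_map h q) A, ultra q B &
    forall y x, A y -> B x -> E (y, x) -> y = h x].
Proof.
move=> f_inj h_inj qD.
have /choice[AB ABP] i : exists AB : set T * set T,
    [/\ ultra (sc_map h q) AB.1, ultra q AB.2 &
        forall x, AB.1 (f i x) -> AB.2 x -> f i x = h x].
  have [fh|/stone_cech_separate[A hA fA]] :=
    pselect (sc_map h q = sc_map (f i) q).
    exists (setT, [set x | f i x = h x]); split => //; first exact: filterT.
    by apply: agreement_ultra.
  by exists (A, f i @^-1` (~` A)); split.
exists [set y | forall i, (AB i).1 y], (D `&` [set x | forall i, (AB i).2 x]).
split.
- by apply: filter_forall => i; have [] := ABP i.
- by apply: filterI => //; apply: filter_forall => i; have [] := ABP i.
- move=> y x Ay [Dx Bx] Eyx; have [i yE] := E_cover Dx Eyx.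
  by have [_ _ AB_h] := ABP i; rewrite yE AB_h // -yE.
Qed.

End FiniteCover.
End Ultrafilters.

(** * Subspaces, products and principal groupoids *)

Lemma continuous_set_type (X Z : topologicalType) (C : set Z) (f : X -> C) :
  continuous (fun x => val (f x)) -> continuous f.
Proof. exact: continuous_comp_initial. Qed.

Lemma set_val_continuous (Z : topologicalType) (C : set Z) :
  continuous (val : C -> Z).
Proof. exact: initial_continuous. Qed.

Lemma set_val2_continuous (Z : topologicalType) (C : set Z) (D : set C) :
  continuous (fun u : D => val (val u)).
Proof.
by move=> u; apply: (@continuous_comp D C Z val val); exact: set_val_continuous.
Qed.

Lemma continuous_pair (X Z W : topologicalType) (f : X -> Z) (g : X -> W) :
  continuous f -> continuous g -> continuous (fun x => (f x, g x)).
Proof.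
move=> cf cg x; apply: (cvg_pair (G := nbhs (f x)) (H := nbhs (g x))).
  exact: cf.
exact: cg.
Qed.

Definition principal_groupoid (G : top_groupoid) :=
  forall a b : arrow G, gsrc a = gsrc b -> grng a = grng b -> a = b.

(** Compatibility with units, inverses and products follows by comparing the
   sources and ranges of both sides. *)
Lemma principal_groupoid_isomorphism (G H : top_groupoid)
    (f : arrow G -> arrow H) (f0 : gunit G -> gunit H) :
  principal_groupoid H -> homeomorphism f -> homeomorphism f0 ->
  (forall a, gsrc (f a) = f0 (gsrc a)) ->
  (forall a, grng (f a) = f0 (grng a)) ->
  groupoid_isomorphism f f0.
Proof.
move=> Hpr fh f0h fs fr; split => //.
- by move=> u; apply: Hpr; rewrite ?(fs, fr) ?(gsrc_one, grng_one).
- move=> a; apply: Hpr.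
    by rewrite fs !gsrc_inv fr.
  by rewrite fr !grng_inv fs.
- move=> a b h h'; apply: Hpr.
    by rewrite fs !gsrc_mul fs.
  by rewrite fr !grng_mul fr.
Qed.

Lemma coarse_src_continuous (R : realType) (X : Type) (d : X -> X -> R) :
  continuous (@coarse_src R X d).
Proof.
apply/continuousP => U oU.
suff : coarse_open (coarse_src (d := d) @^-1` U) by [].
move=> r _; exists (snd @^-1` U) => //.
by apply: open_comp => // a _; exact: cvg_snd.
Qed.

(** * Words and distances in the space of graphs *)

Section Distances.
Context {R : realType} {Gamma : groupType} {S : {fset Gamma}}.
Context {A : sofic_approximation R S}.
Context {d : graph_space A -> graph_space A -> R} (dP : graph_space_metric d).
Implicit Types x y : graph_space A.

Lemma edge_dist_le_size (V : finType) (e : rel V) (x : V) p :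
  path e x p -> edge_dist R e x (last x p) <= (size p)%:R.
Proof.
move=> ep; apply: ge_inf; last by exists p.
by exists 0 => _ [q _ <-]; exact: ler0n.
Qed.

Lemma edge_dist_lt_path (V : finType) (e : rel V) (x y : V) (r : R) :
  connect e x y -> edge_dist R e x y < r ->
  exists p, [/\ path e x p, last x p = y & (size p)%:R < r].
Proof.
move=> /connectP[p0 ep0 yE] /inf_lt[].
  by exists (size p0)%:R, p0.
by move=> _ [p [ep yp] <-] ltr; exists p.
Qed.

(** Only finitely many pairs of distinct components are at distance at most [r];
   the bound [N] on the index of one of the two points avoids all of them. *)
Lemma same_component_far (r : R) : exists N, forall x y,
  d y x <= r -> (N <= projT1 x)%N -> projT1 y = projT1 x.
Proof.
(* The summand 1 turns the lower bound into a strict one. *)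
have [N farN] := gsm_far dP (r + 1); exists N => -[i v] [j w] /= dle Ni.
apply/eqP; apply: contraT => ji.
have far := farN j i ji (leq_trans Ni (leq_addl _ _)).
have : component_dist d j i <= d (in_graph w) (in_graph v).
  apply: ge_inf; last by exists w => //; exists v.
  by exists 0 => _ [a _ [b _ <-]]; exact: (metric_ge0 (gsm_metric dP)).
move=> /(le_trans far)/le_trans/(_ dle).
by rewrite gerDl ler10.
Qed.

(** A letter is a generator together with a flag selecting either its
   permutation of the space of graphs or the inverse of that permutation. As
   the action is only almost multiplicative, this inverse need not be the
   permutation of the inverse generator. *)
Definition letter : finType := (S * bool)%type.

Definition total_inv (g : Gamma) x : graph_space A :=
  in_graph ((sa_map A (projT1 x) g)^-1%g (projT2 x)).

Definition letter_map (l : letter) : graph_space A -> graph_space A :=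
  if l.2 then total_map (val l.1) else total_inv (val l.1).

Definition word_map (w : seq letter) x := foldr letter_map x w.

Definition letter_val (l : letter) : Gamma :=
  if l.2 then val l.1 else (val l.1)^-1%g.

Definition word_val (w : seq letter) : Gamma :=
  foldr (fun l g => letter_val l * g)%g 1%g w.

Lemma total_mapK g : cancel (@total_map R Gamma S A g) (total_inv g).
Proof. by move=> [i v]; rewrite /total_inv /total_map /= permK. Qed.

Lemma total_invK g : cancel (total_inv g) (total_map g).
Proof. by move=> [i v]; rewrite /total_inv /total_map /= permKV. Qed.

Lemma word_map_inj w : injective (word_map w).
Proof.
elim: w => [|[s b] w IHw] x y //= e; apply: IHw; move: e; rewrite /letter_map.
by case: b => /=; [exact: total_map_inj|exact: (can_inj (total_invK _))].
Qed.

Lemma path_word i (v : sa_space A i) p : path (label_adj S (sa_map A i)) v p ->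
  exists2 w, in_graph (last v p) = word_map w (in_graph v) & size w = size p.
Proof.
elim: p v => [|u p IHp] v /=; first by exists [::].
move=> /andP[/existsP[s vu] /IHp[w -> <-]].
have [l ->] : exists l, in_graph u = letter_map l (in_graph v).
  case/orP: vu => /eqP <-; first by exists (s, true).
  by exists (s, false); rewrite /letter_map /= /total_inv /= permK.
by exists (rcons w l); rewrite ?size_rcons // /word_map foldr_rcons.
Qed.

(** This is bounded geometry: the bound on the length of the words does not
   depend on the points, and finitely many words obey it. The maps of the
   words are injections of the whole space, as [agreement_ultra] requires. *)
Lemma entourage_words (r : R) : exists n N, forall y x,
  (N <= projT1 x)%N -> entourage_le d r (y, x) ->
  exists w : n.-bseq letter, y = word_map w x.
Proof.
have [N farN] := same_component_far r.
exists (Num.truncn r).+1, N => y x Nx; rewrite /entourage_le /= => dyx.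
have := farN _ _ dyx Nx; case: x y dyx {Nx} => [i v] [j u] /= + ji.
rewrite -/(in_graph u); subst j => dyx.
have : edge_dist R (label_adj S (sa_map A i)) v u < (Num.truncn r).+1%:R.
  apply: le_lt_trans (truncnS_gt r); rewrite -(gsm_edge dP).
  by rewrite (metric_symm (gsm_metric dP)).
move=> /(edge_dist_lt_path (sa_connected v u))[p [/path_word[w wE wp] pu]].
rewrite ltr_nat => pn; have wn : (size w <= (Num.truncn r).+1)%N.
  by rewrite wp ltnW.
by exists (Bseq wn); rewrite /= -wE pu.
Qed.

Lemma closure2_entourage_words (r : R) p q :
  ~ range (@sc_point (graph_space A)) q ->
  sc_closure2 (entourage_le d r) (p, q) -> exists w, p = sc_map (word_map w) q.
Proof.
move=> nq cpq; have [n [N cover]] := entourage_words r.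
have [w ->] := closure2_finite_cover cover (boundary_tail N nq) cpq.
by exists w.
Qed.

(** Seen inside a single entourage, the extension of a translation has an open
   graph. At a point of the space itself, singletons isolate it; at a boundary
   point, finitely many words compete and the ones that do not agree with the
   translation can be separated from it. *)
Lemma entourage_isolates_graph (r : R) h q : injective h ->
  exists B C, [/\ ultra (sc_map h q) B, ultra q C &
    forall y x, B y -> C x -> entourage_le d r (y, x) -> y = h x].
Proof.
move=> h_inj.
have [[x _ <-]|nq] := pselect (range (@sc_point (graph_space A)) q).
  exists [set h x], [set x]; split; last by move=> y z /= -> ->.
    exact/principal_filterP.
  exact/principal_filterP.
have [n [N cover]] := entourage_words r.
apply: (finite_cover_isolates_graph (f := fun w : n.-bseq letter => word_map w)
  cover _ h_inj (boundary_tail N nq)).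
by move=> w; exact: word_map_inj.
Qed.

(** The open set required in the closure of each entourage is the union of the
   basic open boxes given by [entourage_isolates_graph]: such a box meets the
   closure inside the graph, by [closure2_sub_graph]. *)
Lemma translation_graph_open h : injective h ->
  open [set a : coarse_arrow d | coarse_rng a = sc_map h (coarse_src a)].
Proof.
move=> h_inj.
suff : coarse_open
    [set a : coarse_arrow d | coarse_rng a = sc_map h (coarse_src a)].
  by [].
move=> r r0.
pose P (BC : set (graph_space A) * set (graph_space A)) := forall y x,
  BC.1 y -> BC.2 x -> entourage_le d r (y, x) -> y = h x.
exists [set a | exists2 BC, P BC & ultra a.1 BC.1 /\ ultra a.2 BC.2].
  rewrite openE => -[p q] [BC BCP [/= pB qC]].
  exists ([set u | ultra u BC.1], [set u | ultra u BC.2]).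
    by split; apply/sc_nbhsP; [exists BC.1|exists BC.2].
  by move=> [u v] /= [uB vC]; exists BC.
move=> [[p q] apq]; rewrite /coarse_rng /coarse_src /= => cpq; split.
  move=> ->; have [B [C [hB qC BCP]]] := entourage_isolates_graph r q h_inj.
  by exists (B, C).
by move=> [[B C] BCP [pB qC]]; exact: closure2_sub_graph pB qC BCP cpq.
Qed.

End Distances.

(** * The action on the core *)

Lemma generates_ind (Gamma : groupType) (S : {fset Gamma}) (P : Gamma -> Prop) :
  generates S -> P 1%g -> (forall g h, P g -> P h -> P (g * h^-1)%g) ->
  (forall s, s \in S -> P s) -> forall g, P g.
Proof.
move=> S_gen P1 PB PS g; apply/asboolP.
apply: (S_gen (fun h => `[< P h >])) => [|s /PS Ps]; last exact/asboolP.
split; first exact/asboolP.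
by move=> h k /asboolP Ph /asboolP Pk; apply/asboolP; exact: PB.
Qed.

Section Core.
Context {R : realType} {Gamma : groupType} {S : {fset Gamma}}.
Context {A : sofic_approximation R S} {Y : forall i, {set sa_space A i}}.
Hypothesis Yw : forall i,
  almost_action_witness (sa_fin A i) (sa_eps A i) (sa_map A i) (Y i).
Implicit Types (p q : stone_cech (graph_space A)) (g h : Gamma).

Lemma core_boundary q : core Y q -> ~ range (@sc_point (graph_space A)) q.
Proof. by move=> /(core_boundary_total_set Yw)[]. Qed.

Lemma core_beta_map g q : core Y q -> core Y (beta_map g q).
Proof.
by move=> /mem_set qc; have /set_mem := beta_map_core Yw g (exist _ q qc).
Qed.

(** Otherwise [h^-1 * g], a nontrivial element, would act like the identity on
   a set of [q], whereas it has no fixed points in [Y] far enough out. *)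
Lemma beta_map_free g h q : boundary_of_total_set Y q ->
  beta_map g q = beta_map h q -> g = h.
Proof.
move=> qY gh; apply: contrapT => ngh.
have q_fix : beta_map (h^-1 * g)%g q = beta_map 1%g q.
  by rewrite -(beta_mapM Yw) // gh (beta_mapM Yw) // mulVg.
have injA k := @total_map_inj _ _ _ A k.
have := agreement_ultra (injA _) (injA _) q_fix.
have [B qB mul1] := total_mapM_near Yw 1%g 1%g qY.
have [i ki] := sa_fin_cover A (h^-1 * g)%g.
have qYi : ultra q (total_set Y `&` [set x | (i <= projT1 x)%N]).
  exact: filterI (boundary_total_setP qY) (boundary_tail i qY.2).
move=> /(filterI qB)/(filterI qYi)/ultra_ex[x [[Yx ix] [/mul1 x1 xk]]].
move: x1; rewrite mulg1 => /total_map_inj x1; move: xk; rewrite /= x1.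
case: x Yx ix {x1} => j v /= Yv ij kv.
have : (in_graph (sa_map A j (h^-1 * g)%g v) : {i & sa_space A i}) ==
    Tagged (sa_space A) v by apply/eqP.
rewrite eq_Tagged /=; apply/negP; apply: (witness_free (Yw j)) => //.
  exact: sa_finS ki.
by apply/eqP => k1; apply: ngh; rewrite -(mulKVg h g) k1 mulg1.
Qed.

(** By induction on the word. For an inverse letter, the inverse permutation of
   [s] and the permutation of [s^-1] agree on the orbit of [q], because the
   action on the core is multiplicative. *)
Lemma sc_map_word_core q (w : seq (letter (S := S))) : core Y q ->
  sc_map (word_map (A := A) w) q = beta_map (word_val w) q.
Proof.
have bY p : core Y p -> boundary_of_total_set Y p.
  exact: core_boundary_total_set.
move=> qY; elim: w => [|[s b] w IHw] /=.
  by rewrite (beta_map1 Yw (bY _ qY)); exact: stone_cechP.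
have -> : sc_map (word_map ((s, b) :: w)) q =
    sc_map (letter_map (s, b)) (sc_map (word_map w) q).
  by rewrite sc_map_comp.
have wY := core_beta_map (word_val w) qY.
rewrite IHw -(beta_mapM Yw _ _ (bY _ qY)); case: b => //=.
rewrite -[in LHS](beta_map1 Yw (bY _ wY)) -(mulgV (val s)).
rewrite -(beta_mapM Yw _ _ (bY _ wY)) sc_map_comp.
have -> : letter_map (s, false) \o total_map (val s) = @idfun (graph_space A).
  by apply/funext => x; rewrite /letter_map /= total_mapK.
exact: stone_cechP.
Qed.

Section Metric.
Context {d : graph_space A -> graph_space A -> R} (dP : graph_space_metric d).

Lemma core_arrow_translation p q : core Y q -> (p, q) \in coarse_arrows d ->
  exists g, p = beta_map g q.
Proof.
move=> qY /set_mem[r _ cpq].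
have [w ->] := closure2_entourage_words dP (core_boundary qY) cpq.
by exists (word_val w); exact: sc_map_word_core.
Qed.

(** Translation by a fixed group element displaces the points near the core by
   a bounded distance. The radius has to be uniform over the core, since a map
   into the weak topology is continuous only if it locally stays in the closure
   of a single entourage. *)
Lemma core_displacement : generates S -> forall g, exists2 r : R, 0 < r &
  forall q, core Y q -> ultra q [set x | d (total_map g x) x <= r].
Proof.
have dM := gsm_metric dP.
move=> S_gen; apply: (generates_ind S_gen) => [|h k [r r0 hr] [t t0 kt]|s Ss].
- exists 1 => // q /(core_boundary_total_set Yw)/(total_mapM_near Yw 1%g 1%g).
  move=> [B qB mul1]; apply: filterS qB => x /mul1; rewrite mulg1.
  by move=> /total_map_inj /= ->; rewrite (metric_eq0 dM x x).2.
- exists (r + t); first exact: addr_gt0.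
  move=> q qY; have qB := core_boundary_total_set Yw qY.
  have [B qB1 hk] := total_mapM_near Yw h k^-1%g qB.
  have [C qC kk] := total_mapM_near Yw k k^-1%g qB.
  have [D qD mul1] := total_mapM_near Yw 1%g 1%g qB.
  (* Invariance of the core lets the bounds for [h] and [k] apply at the
     translate of [q] by [k^-1]; the path from [x] to its image under
     [h * k^-1] passes through the image of [x] under [k^-1]. *)
  have q'Y := core_beta_map k^-1%g qY.
  pose y (x : graph_space A) := total_map k^-1%g x.
  have qh : ultra q [set x | d (total_map h (y x)) (y x) <= r] := hr _ q'Y.
  have qk : ultra q [set x | d (total_map k (y x)) (y x) <= t] := kt _ q'Y.
  apply: filterS (filterI (filterI qB1 (filterI qC qD)) (filterI qh qk)).
  move=> x /= [[/hk <- [/kk kkx /mul1 x1]] [dh dk]].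
  move: kkx x1; rewrite mulg1 mulgV => kkx /total_map_inj x1.
  apply: le_trans (metric_tri dM (total_map k^-1%g x) _ _) (lerD dh _).
  rewrite -/(y x).
  by move: dk; rewrite kkx x1 (metric_symm dM).
- exists 1 => // q _; apply: filterS (@filterT _ (ultra q) _) => -[i v] _ /=.
  rewrite (metric_symm dM) (gsm_edge dP).
  apply: (edge_dist_le_size (x := v) (p := [:: sa_map A i s v])).
  by rewrite /= andbT; apply/existsP; exists (FSetSub Ss); rewrite eqxx.
Qed.

Lemma translation_closure2 (r : R) g q :
  ultra q [set x | d (total_map g x) x <= r] ->
  sc_closure2 (entourage_le d r) (beta_map g q, q).
Proof.
move=> qr; apply/sc_closure2P => B C /= gB qC.
have [x [[Bx Cx] dx]] := ultra_ex (filterI (filterI gB qC) qr).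
by exists (total_map g x), x.
Qed.

End Metric.
End Core.

(** * The isomorphism *)

Section Isomorphism.
Context {R : realType} {Gamma : groupType} {S : {fset Gamma}}.
Context {A : sofic_approximation R S} {Y : forall i, {set sa_space A i}}.
Hypothesis Yw : forall i,
  almost_action_witness (sa_fin A i) (sa_eps A i) (sa_map A i) (Y i).
Context {d : graph_space A -> graph_space A -> R} (dP : graph_space_metric d).
Hypothesis S_generates : generates S.

Let G := @reduction (boundary_groupoid (gsm_metric dP)) (core_units Y).
Let H := core_transformation_groupoid Yw.

Lemma core_unit_subproof (u : gunit G) : val (val u) \in core Y.
Proof. by apply/mem_set; have /set_mem := valP u. Qed.

Definition core_unit (u : gunit G) : gunit H :=
  exist _ (val (val u)) (core_unit_subproof u).

Lemma core_in_boundary (z : core Y) : val z \in @sc_boundary (graph_space A).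
Proof. by apply/mem_set/(core_boundary Yw)/set_mem/valP. Qed.

Definition boundary_point (z : core Y) :
    set_type (@sc_boundary (graph_space A)) :=
  exist _ (val z) (core_in_boundary z).

Lemma boundary_unit_subproof (z : core Y) : boundary_point z \in core_units Y.
Proof. by apply/mem_set/set_mem/(valP z). Qed.

Definition boundary_unit (z : gunit H) : gunit G :=
  exist _ (boundary_point z) (boundary_unit_subproof z).

Lemma core_unit_homeomorphism : homeomorphism core_unit.
Proof.
exists boundary_unit; split.
- by move=> u; do 2!apply: val_inj.
- by move=> z; apply: val_inj.
- by apply: continuous_set_type; exact: set_val2_continuous.
- do 2!apply: continuous_set_type.
  exact: set_val_continuous.
Qed.

Definition core_arrow (a : arrow G) : coarse_arrow d := val (val a).

Lemma core_arrow_inj (a b : arrow G) : core_arrow a = core_arrow b -> a = b.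
Proof. by move=> ab; do 2!apply: val_inj. Qed.

Lemma core_arrow_continuous : continuous core_arrow.
Proof. exact: set_val2_continuous. Qed.

Lemma core_arrow_group_element (a : arrow G) :
  {g | coarse_rng (core_arrow a) = beta_map g (coarse_src (core_arrow a))}.
Proof.
apply: cid; apply: (core_arrow_translation Yw dP) (valP (core_arrow a)).
exact/set_mem/(core_unit_subproof (gsrc a)).
Qed.

Definition arrow_translation (a : arrow G) : arrow H :=
  (core_unit (gsrc a), sval (core_arrow_group_element a)).

Lemma translation_arrowP (b : arrow H) :
  (beta_map b.2 (val b.1), val b.1) \in coarse_arrows d.
Proof.
have [r r0 rP] := core_displacement Yw dP S_generates b.2.
apply/mem_set; exists r => //; apply: translation_closure2; apply: rP.
exact/set_mem/valP.
Qed.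

Definition translation_coarse_arrow (b : arrow H) : coarse_arrow d :=
  exist _ (beta_map b.2 (val b.1), val b.1) (translation_arrowP b).

Lemma translation_boundary_subproof (b : arrow H) :
  (translation_coarse_arrow b : arrow (coarse_groupoid (gsm_metric dP))) \in
  @red_arrows (coarse_groupoid (gsm_metric dP)) (@sc_boundary (graph_space A)).
Proof.
apply/mem_set; split; first exact/set_mem/(core_in_boundary b.1).
exact/set_mem/(core_in_boundary (core_act Yw b.2 b.1)).
Qed.

Definition translation_boundary_arrow (b : arrow H) :
  arrow (boundary_groupoid (gsm_metric dP)) :=
  exist _ (translation_coarse_arrow b) (translation_boundary_subproof b).

Lemma translation_core_subproof (b : arrow H) :
  translation_boundary_arrow b \in
  @red_arrows (boundary_groupoid (gsm_metric dP)) (core_units Y).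
Proof.
apply/mem_set; split; first exact/set_mem/(valP b.1).
exact/set_mem/(valP (core_act Yw b.2 b.1)).
Qed.

Definition translation_arrow (b : arrow H) : arrow G :=
  exist _ (translation_boundary_arrow b) (translation_core_subproof b).

Lemma arrow_translation_src a : gsrc (arrow_translation a) = core_unit (gsrc a).
Proof. by []. Qed.

Lemma arrow_translation_rng a : grng (arrow_translation a) = core_unit (grng a).
Proof.
by apply: val_inj; exact: esym (svalP (core_arrow_group_element a)).
Qed.

(** This is freeness of the action on the core. *)
Lemma core_transformation_principal : principal_groupoid H.
Proof.
move=> [z g] [z' h] /= zz'; subst z' => /(congr1 val) /= gh; congr pair.
apply: (beta_map_free Yw _ gh).
exact/(core_boundary_total_set Yw)/set_mem/valP.
Qed.

Lemma arrow_translationK : cancel arrow_translation translation_arrow.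
Proof.
move=> a; apply: core_arrow_inj; apply: coarse_eq => //.
exact: esym (svalP (core_arrow_group_element a)).
Qed.

Lemma translation_arrowK : cancel translation_arrow arrow_translation.
Proof.
move=> b; apply: core_transformation_principal.
  by apply: val_inj.
rewrite arrow_translation_rng; exact: val_inj.
Qed.

(** The group element of an arrow is locally constant: near [a], arrows lie in
   the open graph of the translation by the element of [a], and by freeness
   this translation is their own. *)
Lemma arrow_translation_continuous : continuous arrow_translation.
Proof.
have src_cont : continuous (fun a : arrow G => core_unit (gsrc a)).
  apply: continuous_set_type => a.
  apply: (@continuous_comp _ _ _ core_arrow (@coarse_src R _ d)).
    exact: core_arrow_continuous.
  exact: coarse_src_continuous.
pose gamma (a : arrow G) : discrete_topology Gamma :=
  sval (core_arrow_group_element a).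
have gammaP (a : arrow G) : beta_map (gamma a) (coarse_src (core_arrow a)) =
    coarse_rng (core_arrow a).
  exact: esym (svalP (core_arrow_group_element a)).
suff gamma_cont : continuous gamma.
  exact: continuous_pair src_cont gamma_cont.
move=> a; apply/discrete_cvg.
  exact: (@fmap_filter _ _ gamma (nbhs a) (nbhs_filter a)).
have /core_arrow_continuous near_a : nbhs (core_arrow a)
    [set c | coarse_rng c = beta_map (gamma a) (coarse_src c)].
  apply: open_nbhs_nbhs; split; last exact: esym (gammaP a).
  exact: (translation_graph_open dP (@total_map_inj _ _ _ A (gamma a))).
apply: (@filterS _ (nbhs a) (nbhs_filter a) _
  (gamma @^-1` [set gamma a]) _ near_a) => b bg.
apply: (beta_map_free Yw _ (etrans (gammaP b) bg)).
exact/(core_boundary_total_set Yw)/set_mem/(core_unit_subproof (gsrc b)).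
Qed.

(** For fixed [g], all the pairs [(beta_map g w, w)] with [w] in the core lie in
   the closure of one entourage, and there an open set of the weak topology is
   the trace of an open set [O] of the product. *)
Lemma translation_arrow_continuous : continuous translation_arrow.
Proof.
do 2!apply: continuous_set_type.
apply/continuousP => U oU; rewrite openE => -[z g] Uzg.
have [r r0 rP] := core_displacement Yw dP S_generates g.
have [O oO UO] := oU r r0.
have cl (w : core Y) :
    sc_closure2 (entourage_le d r) (beta_map g (val w), val w).
  exact/translation_closure2/rP/set_mem/(valP w).
have cont : continuous (fun w : core Y => (beta_map g (val w), val w)).
  apply: continuous_pair; last exact: set_val_continuous.
  move=> w; apply: (@continuous_comp _ _ _ (val : core Y -> _) (beta_map g)).
    exact: set_val_continuous.
  exact: sc_map_continuous.
have Oz : O (beta_map g (val z), val z).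
  by move/(UO (translation_coarse_arrow (z, g)) (cl z)) : Uzg.
exists ([set w | O (beta_map g (val w), val w)], [set g]).
  split; last exact: discrete_set1.
  exact/cont/open_nbhs_nbhs.
move=> [w h] /= [Ow ->].
exact/(UO (translation_coarse_arrow (w, g)) (cl w)).
Qed.

End Isomorphism.

Theorem theorem3p9 (R : realType) (Gamma : groupType) (S : {fset Gamma})
    (S_generates : generates S) (Gamma_sofic : sofic R Gamma)
    (A : sofic_approximation R S)
    (d : graph_space A -> graph_space A -> R) (d_metric : graph_space_metric d)
    (Y : forall i : nat, {set sa_space A i})
    (Y_witness : forall i : nat,
       almost_action_witness (sa_fin A i) (sa_eps A i) (sa_map A i) (Y i)) :
  isomorphic_top_groupoids
    (@reduction (boundary_groupoid (gsm_metric d_metric)) (core_units Y))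
    (core_transformation_groupoid Y_witness).
Proof.
exists (arrow_translation Y_witness (dP := d_metric)).
exists (core_unit Y_witness (dP := d_metric)).
apply: principal_groupoid_isomorphism.
- exact: core_transformation_principal.
- exists (translation_arrow d_metric S_generates); split.
  + exact: arrow_translationK.
  + exact: translation_arrowK.
  + exact: arrow_translation_continuous.
  + exact: translation_arrow_continuous.
- exact: core_unit_homeomorphism.
- exact: arrow_translation_src.
- exact: arrow_translation_rng.
Qed.
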